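(* Let $R$ be an associative ring with identity and let $C$ be a $\Sigma$-self-orthogonal left $R$-module. Then, for every positive integer $n$, $\mathrm{l.}\mathscr{P}_C\text{-}\mathrm{gl.dim}(R)=n$ if and only if $\mathrm{l.gl.dim}(R)=n$ and $C$ is a projective generator of $R$-$\mathrm{Mod}$, that is, $\mathrm{Add}_R(C)=P(R)$. In particular, $\mathrm{l.}\mathscr{P}_C\text{-}\mathrm{gl.dim}(R)=0$ if and only if $R\text{-}\mathrm{Mod}=\mathrm{Add}_R(C)=P(R)$.
   Context: Modules are unitary left $R$-modules and $R$-$\mathrm{Mod}$ is the category of all of them. $C$ is $\Sigma$-self-orthogonal if $\mathrm{Ext}_R^{i}(C,C^{(I)})=0$ for every $i\geq 1$ and every set $I$ (where $C^{(I)}$ is the direct sum of copies of $C$ indexed by $I$). $\mathrm{Add}_R(C)$ is the class of all $R$-modules isomorphic to direct summands of direct sums of copies of $C$; $P(R)$ is the class of all projective $R$-modules. For a module $M$, its exact left $\mathrm{Add}_R(C)$-dimension is the least integer $m\geq 0$ for which there is an exact sequence $0\to A_m\to\cdots\to A_0\to M\to 0$ with all $A_i\in\mathrm{Add}_R(C)$, and $\infty$ if there is none. $\mathrm{l.}\mathscr{P}_C\text{-}\mathrm{gl.dim}(R)$ is the supremum of these dimensions over all $R$-modules $M$. $\mathrm{l.gl.dim}(R)$ is the usual left global dimension of $R$. *)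

(* Defs.v *)
From HB Require Import structures.
From mathcomp Require Import all_boot all_order all_algebra.
From mathcomp Require Import ring_quotient.
From mathcomp Require Import finmap all_classical.
From mathcomp Require Import constructive_ereal.

Set Implicit Arguments.
Unset Strict Implicit.
Unset Printing Implicit Defensive.

Import GRing.Theory.
Local Open Scope ring_scope.
Local Open Scope classical_set_scope.

(* Rings are [pzRingType]s, so that the zero ring is not excluded. *)

Section Kernel.
Context (R : pzRingType) (U V : lmodType R) (f : {linear U -> V}).

Definition ker_pred : {pred U} := fun x => f x == 0.

Lemma ker_pred_submod : submod_closed ker_pred.
Proof.
split=> [|a x y]; rewrite !unfold_in ?linear0 // => /eqP fx /eqP fy.
by rewrite linearP fx fy scaler0 addr0.
Qed.

HB.instance Definition _ := GRing.isSubmodClosed.Build R U ker_pred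
  ker_pred_submod.

Record ker_module := KerModule { ker_val : U; ker_valP : ker_val \in ker_pred }.

HB.instance Definition _ := [isSub of ker_module for ker_val].
HB.instance Definition _ := [Choice of ker_module by <:].
HB.instance Definition _ := [SubChoice_isSubLmodule of ker_module by <:].

Lemma ker_val_is_linear : linear ker_val.
Proof. by []. Qed.

HB.instance Definition _ :=
  GRing.isLinear.Build R ker_module U _ ker_val ker_val_is_linear.

End Kernel.

(* The direct sum C^(I) of copies of C indexed by an arbitrary type I:
   the functions I -> C with finite support. *)
Section DirectSum.
Context (R : pzRingType) (I : Type) (C : lmodType R).

Definition fin_supp : {pred I -> C} :=
  fun f => `[< finite_set [set i | f i != 0] >].

Lemma fin_supp_submod : submod_closed fin_supp.
Proof.
split=> [|a f g]; rewrite !unfold_in.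
  apply/asboolP; rewrite (_ : [set _ | _] = set0) //.
  by apply/seteqP; split=> i //=; rewrite eqxx.
move=> /asboolP fS /asboolP gS; apply/asboolP.
have fgS : finite_set ([set i | f i != 0] `|` [set i | g i != 0]).
  by rewrite finite_setU.
apply: sub_finite_set fgS => i /=; apply: contra_neqP => /not_orP[].
move=> /negP; rewrite negbK => /eqP fi0 /negP; rewrite negbK => /eqP gi0.
by rewrite (_ : (a *: f + g) i = a *: f i + g i) // fi0 gi0 scaler0 addr0.
Qed.

HB.instance Definition _ := GRing.isSubmodClosed.Build R (I -> C) fin_supp
  fin_supp_submod.

Record dsum := DSum { dsum_fun :> I -> C; dsumP : dsum_fun \in fin_supp }.

HB.instance Definition _ := [isSub of dsum for dsum_fun].
HB.instance Definition _ := [Choice of dsum by <:].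
HB.instance Definition _ := [SubChoice_isSubLmodule of dsum by <:].

End DirectSum.

Section ModuleClasses.
Context (R : pzRingType).
Implicit Types C M P : lmodType R.

Definition projective P : Prop :=
  forall (A B : lmodType R) (g : {linear A -> B}) (f : {linear P -> B}),
    (forall b, exists a, g a = b) ->
    exists h : {linear P -> A}, forall x, g (h x) = f x.

Definition generator C : Prop :=
  forall M, exists (I : Type) (f : {linear dsum I C -> M}),
    forall x, exists s, f s = x.

Definition projective_generator C : Prop := projective C /\ generator C.

(* M is isomorphic to a direct summand of C^(I) iff M * N is isomorphic to
   C^(I) for some module N. *)
Definition Add C M : Prop :=
  exists (I : Type) (N : lmodType R) (f : {linear (M * N)%type -> dsum I C}),
    bijective f.

End ModuleClasses.

(* An exact sequence ... -> L_2 -> L_1 -> L_0 -> M -> 0. *)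
Record left_resolution (R : pzRingType) (M : lmodType R) := LeftResolution {
  res_obj :> nat -> lmodType R;
  res_diff : forall i, {linear res_obj i.+1 -> res_obj i};
  res_aug : {linear res_obj 0 -> M};
  res_aug_surj : forall x, exists y, res_aug y = x;
  res_exact_aug : forall x, res_aug x = 0 <-> exists y, res_diff 0 y = x;
  res_exact : forall i (x : res_obj i.+1),
    res_diff i x = 0 <-> exists y, res_diff i.+1 y = x }.

Section FreeResolution.
Context (R : pzRingType).

(* The linear map from the free module R^(I) to M sending the i-th basis
   vector to a i. *)
Section FreeLift.
Context (I : choiceType) (M : lmodType R) (a : I -> M).

Definition free_lift (f : dsum I R^o) : M :=
  \sum_(i \in [set: I]) (f i : R) *: a i.

Lemma free_liftE (f : dsum I R^o) (A : set I) : [set i | f i != 0] `<=` A ->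
  free_lift f = \sum_(i \in A) (f i : R) *: a i.
Proof.
move=> fA; apply/esym; apply: fsbig_widen => // i [_ /= iA].
suff -> : f i = 0 by rewrite scale0r.
by apply/eqP/negP => /negP /fA.
Qed.

Lemma free_lift_is_linear : linear free_lift.
Proof.
move=> c f g.
have /asboolP fS := dsumP f; have /asboolP gS := dsumP g.
have /asboolP hS := dsumP (c *: f + g).
pose A := [set i | f i != 0] `|` [set i | g i != 0]
  `|` [set i | (c *: f + g) i != 0].
have Afin : finite_set A by rewrite !finite_setU.
rewrite !(@free_liftE _ A); do ?by move=> i ?; rewrite /A /=; tauto.
rewrite !(fsbig_finite _ _ Afin) scaler_sumr -big_split.
by apply: eq_bigr => i _ /=; rewrite scalerDl scalerA.
Qed.

HB.instance Definition _ :=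
  GRing.isLinear.Build R (dsum I R^o) M _ free_lift free_lift_is_linear.

End FreeLift.

Section FreeBasis.
Context (I : choiceType).

Definition free_basis_fun (i : I) : I -> R^o := fun j => (j == i)%:R.

Lemma free_basis_subproof i : free_basis_fun i \in @fin_supp R I R^o.
Proof.
apply/asboolP; apply: sub_finite_set (finite_set1 i) => j /=.
by rewrite /free_basis_fun; case: (eqVneq j i) => [->|_] //; rewrite eqxx.
Qed.

Definition free_basis i : dsum I R^o := DSum (free_basis_subproof i).

Lemma free_lift_basis (M : lmodType R) (a : I -> M) i :
  free_lift a (free_basis i) = a i.
Proof.
rewrite (@free_liftE _ _ _ _ [set i]) => [|j /=].
  by rewrite fsbig_set1 /= /free_basis_fun eqxx scale1r.
by rewrite /free_basis_fun; case: (eqVneq j i) => [->|_] //; rewrite eqxx.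
Qed.

Lemma free_basis_gen (f : dsum I R^o) : free_lift free_basis f = f.
Proof.
have /asboolP fS := dsumP f.
rewrite (@free_liftE _ _ _ _ [set i | f i != 0]) // (fsbig_finite _ _ fS).
apply/val_inj/funext => j /=.
rewrite (_ : dsum_fun _ j =
  \sum_(i <- fset_set [set i | f i != 0]) f i * (j == i)%:R); last first.
  by elim/big_rec2: _ => // i y s _ <-.
have [fj0|fj0] := eqVneq (f j) 0.
  by rewrite fj0 big1 // => i _; case: eqVneq => [<-|]; rewrite ?fj0 ?mulr0 ?mul0r.
rewrite (big_fsetD1 j) /=; last by rewrite in_fset_set // inE.
rewrite eqxx mulr1 big1_fset ?addr0 // => i; rewrite !inE => /andP[ij _] _.
by rewrite eq_sym (negPf ij) mulr0.
Qed.

Lemma free_projective : projective (dsum I R^o : lmodType R).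
Proof.
move=> A B g f /(_ (f (free_basis _))) gS.
have /choice[a ga] : forall i, exists y, g y = f (free_basis i) by move=> i.
exists (free_lift a) => s; have /asboolP sS := dsumP s.
rewrite -[in RHS](free_basis_gen s).
rewrite /= (@free_liftE _ _ a _ [set i | s i != 0]) //.
rewrite (@free_liftE _ _ free_basis _ [set i | s i != 0]) //.
rewrite !(fsbig_finite _ _ sS) !linear_sum.
by apply: eq_bigr => i _; rewrite !linearZ ga.
Qed.

End FreeBasis.

(* The free module on the underlying set of M, with its canonical map to M. *)
Definition free_cover (M : lmodType R) : lmodType R := dsum M R^o.

Definition free_aug (M : lmodType R) : {linear free_cover M -> M} :=
  free_lift (fun x : M => x).

Lemma free_aug_surj (M : lmodType R) (x : M) : exists f, free_aug M f = x.
Proof. by exists (free_basis x); apply: free_lift_basis. Qed.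

Fixpoint syzygy (M : lmodType R) (n : nat) : lmodType R :=
  if n is n'.+1 then ker_module (free_aug (syzygy M n')) else M.

Definition free_diff (M : lmodType R) (i : nat) :
    {linear free_cover (syzygy M i.+1) -> free_cover (syzygy M i)} :=
  @ker_val _ _ _ (free_aug (syzygy M i)) \o free_aug (syzygy M i.+1).

Lemma free_diff_image M i (x : free_cover (syzygy M i)) :
  free_aug _ x = 0 <-> exists y, free_diff M i y = x.
Proof.
split=> [/eqP x0|[y <-]]; last first.
  have := ker_valP (free_aug _ y : ker_module (free_aug (syzygy M i))).
  by rewrite unfold_in => /eqP.
by have [y yx] := free_aug_surj (KerModule x0); exists y; rewrite /= yx.
Qed.

Lemma free_diff_exact M i (x : free_cover (syzygy M i.+1)) :
  free_diff M i x = 0 <-> exists y, free_diff M i.+1 y = x.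
Proof.
rewrite -free_diff_image /=; split=> [x0|->]; last exact: linear0.
exact: val_inj.
Qed.

Definition free_resolution (M : lmodType R) : left_resolution M :=
  @LeftResolution R M (fun i => free_cover (syzygy M i)) (free_diff M)
    (free_aug M) (@free_aug_surj M) (free_diff_image (M := M) (i := 0))
    (free_diff_exact (M := M)).

Lemma free_resolution_projective M i : projective (free_resolution M i).
Proof. exact: free_projective. Qed.

End FreeResolution.

(* Hom_R(M, N) as an abelian group under pointwise addition. *)
Section HomGroup.
Context (R : pzRingType) (M N : lmodType R).

Definition HomR : Type := {linear M -> N}.

HB.instance Definition _ := gen_eqMixin HomR.
HB.instance Definition _ := gen_choiceMixin HomR.

Definition hom_fun (f : HomR) : M -> N := f.

Lemma hom_eq (f g : HomR) : hom_fun f =1 hom_fun g -> f = g.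
Proof.
rewrite /hom_fun; case: f g => f [[fN] [fZ]] [g [[gN] [gZ]]] /= /funext fg.
by rewrite -fg in gN gZ *; congr (GRing.Linear.Pack (GRing.Linear.Class _ _));
  congr (_ _); apply: Prop_irrelevance.
Qed.

Definition hom_zero : HomR := \0.
Definition hom_opp (f : HomR) : HomR := \- (hom_fun f).
Definition hom_add (f g : HomR) : HomR := hom_fun f \+ hom_fun g.

Lemma hom_addA : associative hom_add.
Proof. by move=> f g h; apply: hom_eq => x; apply: addrA. Qed.
Lemma hom_addC : commutative hom_add.
Proof. by move=> f g; apply: hom_eq => x; apply: addrC. Qed.
Lemma hom_add0 : left_id hom_zero hom_add.
Proof. by move=> f; apply: hom_eq => x; apply: add0r. Qed.
Lemma hom_addN : left_inverse hom_zero hom_opp hom_add.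
Proof. by move=> f; apply: hom_eq => x; apply: addNr. Qed.

HB.instance Definition _ :=
  GRing.isZmodule.Build HomR hom_addA hom_addC hom_add0 hom_addN.

End HomGroup.

(* The cohomology of 0 -> Hom(L_0, N) -> Hom(L_1, N) -> ... *)
Section Cohomology.
Context (R : pzRingType) (M : lmodType R) (L : left_resolution M).
Context (N : lmodType R).

Definition codiff i (f : HomR (L i) N) : HomR (L i.+1) N :=
  hom_fun f \o res_diff L i.

Lemma codiff_is_zmod_morphism i : zmod_morphism (@codiff i).
Proof. by move=> f g; apply: hom_eq. Qed.

HB.instance Definition _ i :=
  GRing.isZmodMorphism.Build (HomR (L i) N) (HomR (L i.+1) N) (@codiff i)
    (codiff_is_zmod_morphism (i := i)).

Section Degree.
Context (i : nat).

Definition cocycle : {pred HomR (L i) N} := fun f => codiff f == 0.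

Lemma cocycle_zmod : zmod_closed cocycle.
Proof.
split=> [|f g]; rewrite !unfold_in ?raddf0 // => /eqP f0 /eqP g0.
by rewrite raddfB /= f0 g0 subr0.
Qed.

HB.instance Definition _ :=
  GRing.isZmodClosed.Build (HomR (L i) N) cocycle cocycle_zmod.

Record cocycles :=
  Cocycle { cocycle_val :> HomR (L i) N; cocycleP : cocycle_val \in cocycle }.

HB.instance Definition _ := [isSub of cocycles for cocycle_val].
HB.instance Definition _ := [Choice of cocycles by <:].
HB.instance Definition _ := [SubChoice_isSubZmodule of cocycles by <:].

End Degree.

Definition is_coboundary i : HomR (L i) N -> Prop :=
  match i with
  | 0 => fun f => f = 0
  | j.+1 => fun f => exists g : HomR (L j) N, codiff g = f
  end.

Definition coboundary i : {pred cocycles i} :=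
  fun z => `[< is_coboundary (cocycle_val z) >].

Lemma coboundary_zmod i : zmod_closed (@coboundary i).
Proof.
split=> [|f g]; rewrite !unfold_in.
  by apply/asboolP; case: i => [|i] //=; exists 0; rewrite raddf0.
move=> /asboolP + /asboolP +; case: i f g => [|i] f g /=.
  by move=> f0 g0; apply/asboolP; rewrite /= f0 g0 subr0.
by move=> [u uf] [v vg]; apply/asboolP; exists (u - v); rewrite raddfB /= uf vg.
Qed.

HB.instance Definition _ i :=
  GRing.isZmodClosed.Build (cocycles i) (@coboundary i) (@coboundary_zmod i).

Definition cohomology i : zmodType := Quotient.quot (@coboundary i).

End Cohomology.

(* Ext^i_R(M, N) computed by the standard free resolution of M. *)
Definition Ext (R : pzRingType) (i : nat) (M N : lmodType R) : zmodType :=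
  cohomology (free_resolution M) N i.

Definition Sigma_self_orthogonal (R : pzRingType) (C : lmodType R) : Prop :=
  forall (i : nat) (I : Type), (1 <= i)%N ->
    forall x : Ext i C (dsum I C), x = 0.

Section Dimensions.
Context (R : pzRingType).
Implicit Types (X : lmodType R -> Prop) (M : lmodType R).

(* There is an exact sequence 0 -> L_m -> ... -> L_0 -> M -> 0 with all L_i
   in the class X. *)
Definition has_resolution X M (m : nat) : Prop :=
  exists L : left_resolution M,
    (forall i, (i <= m)%N -> X (L i)) /\
    (forall i, (m < i)%N -> forall x : L i, x = 0).

(* Dimensions live in the extended integers, whose order is the usual one and
   in which +oo is the value at modules without finite resolution. *)
Definition left_dim X M : \bar int :=
  if pselect (exists m, `[< has_resolution X M m >]) is left ex_m
  then (ex_minn ex_m)%:Z%:E else +oo%E.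

(* The zero module makes the set nonempty, so the default -oo is not taken. *)
Definition left_gl_dim X : \bar int :=
  supremum -oo%E [set d | exists M, d = left_dim X M].

End Dimensions.

Definition gl_dim (R : pzRingType) : \bar int := left_gl_dim (@projective R).

Definition PC_gl_dim (R : pzRingType) (C : lmodType R) : \bar int :=
  left_gl_dim (Add C).

(* Main.v *)
(* If every module has a finite Add(C)-resolution, then every module is a
   quotient of a sum of copies of C, so C is a generator. Moreover
   Ext^i(C, A) = 0 for i >= 1 and A in Add(C), and shifting dimensions along a
   finite Add(C)-resolution of N gives Ext^1(C, N) = 0 for every N, so C is
   projective. Then Add(C) is the class of projectives and the two global
   dimensions are suprema of the same set. *)
Require Import Defs.
From HB Require Import structures.
From mathcomp Require Import all_boot all_order all_algebra.
From mathcomp Require Import ring_quotient.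
From mathcomp Require Import finmap all_classical.
From mathcomp Require Import constructive_ereal.

Set Implicit Arguments.
Unset Strict Implicit.
Unset Printing Implicit Defensive.

Import GRing.Theory.
Local Open Scope ring_scope.
Local Open Scope classical_set_scope.

(** * Factorization and splitting of linear maps *)

Section LinearMaps.
Context (R : pzRingType).
Implicit Types U V W : lmodType R.

Lemma linear_bundle U V (f : U -> V) :
  linear f -> exists g : {linear U -> V}, g =1 f.
Proof.
move=> lf.
pose g : {linear U -> V} := HB.pack f (GRing.isLinear.Build R U V _ f lf).
by exists g.
Qed.

(** A set-theoretic section [s] of [p] is enough: [f] kills the kernel of [p], so [f \o s] does not
    depend on the preimages chosen and is linear even if [s] is not. *)
Lemma linear_factor_surj U V W (p : {linear U -> V}) (f : {linear U -> W}) :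
    (forall v, exists u, p u = v) -> (forall u, p u = 0 -> f u = 0) ->
  exists g : {linear V -> W}, forall u, g (p u) = f u.
Proof.
move=> /choice[s ps] pf.
have fs u v : p u = v -> f u = f (s v).
  by move=> puv; apply/subr0_eq; rewrite -linearB pf // linearB puv ps subrr.
have /linear_bundle[g gE] : linear (f \o s).
  by move=> a x y /=; rewrite -linearP; apply/esym/fs; rewrite linearP !ps.
by exists g => u; rewrite gE /=; apply/esym/fs.
Qed.

Lemma linear_factor_ker U V W (g : {linear V -> W}) (f : {linear U -> V}) :
    (forall u, g (f u) = 0) ->
  exists h : {linear U -> ker_module g}, forall u, ker_val (h u) = f u.
Proof.
move=> gf0.
have gf u : f u \in ker_pred g by rewrite unfold_in gf0.
have /linear_bundle[h hE] : linear (fun u => KerModule (gf u)).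
  by move=> a x y; apply: val_inj; rewrite /= linearP.
by exists h => u; rewrite hE.
Qed.

Lemma ker_valE V W (g : {linear V -> W}) (k : ker_module g) : g (ker_val k) = 0.
Proof. by have := ker_valP k; rewrite unfold_in => /eqP. Qed.

Lemma linear_inverse U V (f : {linear U -> V}) : bijective f ->
  exists g : {linear V -> U}, cancel f g /\ cancel g f.
Proof.
case=> g fK gK.
have /linear_bundle[h hE] : linear g by apply: can2_linear fK gK.
by exists h; split=> x; rewrite hE.
Qed.

Lemma projective_retract U V (s : {linear U -> V}) (r : {linear V -> U}) :
  cancel s r -> projective V -> projective U.
Proof.
move=> sK Vproj A B g f gS; have [h gh] := Vproj A B g (f \o r) gS.
by exists (h \o s) => x; rewrite /= gh /= sK.
Qed.

Lemma projective_section U V (r : {linear V -> U}) :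
    projective U -> (forall u, exists v, r v = u) ->
  exists s : {linear U -> V}, cancel s r.
Proof. by move=> Uproj rS; have [s sK] := Uproj _ _ r idfun rS; exists s. Qed.

End LinearMaps.

(** * Universal property of direct sums of copies of a module *)

Section DirectSumLift.
Context (R : pzRingType) (I : choiceType) (C M : lmodType R).
Context (h : I -> {linear C -> M}).

Definition dsum_lift (s : dsum I C) : M := \sum_(i \in [set: I]) h i (s i).

Lemma dsum_liftE (s : dsum I C) (A : set I) : [set i | s i != 0] `<=` A ->
  dsum_lift s = \sum_(i \in A) h i (s i).
Proof.
move=> sA; apply/esym; apply: fsbig_widen => // i [_ /= iA].
suff -> : s i = 0 by rewrite linear0.
by apply/eqP/negP => /negP /sA.
Qed.

Lemma dsum_lift_is_linear : linear dsum_lift.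
Proof.
move=> c f g.
have /asboolP fS := dsumP f; have /asboolP gS := dsumP g.
have /asboolP hS := dsumP (c *: f + g).
(* A common finite index set over which all three sums can be written. *)
pose A := [set i | f i != 0] `|` [set i | g i != 0]
  `|` [set i | (c *: f + g) i != 0].
have Afin : finite_set A by rewrite !finite_setU.
rewrite !(@dsum_liftE _ A); do ?by move=> i ?; rewrite /A /=; tauto.
rewrite !(fsbig_finite _ _ Afin) scaler_sumr -big_split.
by apply: eq_bigr => i _ /=; rewrite -linearP.
Qed.

HB.instance Definition _ :=
  GRing.isLinear.Build R (dsum I C) M _ dsum_lift dsum_lift_is_linear.

End DirectSumLift.

Section DirectSumInjection.
Context (R : pzRingType) (I : choiceType) (C : lmodType R) (i : I).

Definition dsum_inj_fun (c : C) : I -> C := fun j => if j == i then c else 0.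

Lemma dsum_inj_subproof c : dsum_inj_fun c \in @fin_supp R I C.
Proof.
apply/asboolP; apply: sub_finite_set (finite_set1 i) => j /=.
by rewrite /dsum_inj_fun; case: (eqVneq j i) => [->|_] //; rewrite eqxx.
Qed.

Definition dsum_inj c : dsum I C := DSum (dsum_inj_subproof c).

Lemma dsum_inj_is_linear : linear dsum_inj.
Proof.
move=> a x y; apply/val_inj/funext => j.
change (dsum_inj_fun (a *: x + y) j = a *: dsum_inj_fun x j + dsum_inj_fun y j).
by rewrite /dsum_inj_fun; case: ifP => // _; rewrite scaler0 addr0.
Qed.

HB.instance Definition _ :=
  GRing.isLinear.Build R C (dsum I C) _ dsum_inj dsum_inj_is_linear.

End DirectSumInjection.

Section DirectSumTheory.
Context (R : pzRingType) (I : choiceType) (C : lmodType R).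

Lemma dsum_lift_inj (M : lmodType R) (h : I -> {linear C -> M}) i c :
  dsum_lift h (dsum_inj i c) = h i c.
Proof.
rewrite (@dsum_liftE _ _ _ _ _ _ [set i]) => [|j /=].
  by rewrite fsbig_set1 /= /dsum_inj_fun eqxx.
by rewrite /dsum_inj_fun; case: (eqVneq j i) => [->|_] //; rewrite eqxx.
Qed.

Lemma dsum_lift_id (s : dsum I C) : dsum_lift (@dsum_inj R I C) s = s.
Proof.
have /asboolP sS := dsumP s.
rewrite (@dsum_liftE _ _ _ _ _ _ [set i | s i != 0]) // (fsbig_finite _ _ sS).
apply/val_inj/funext => j /=.
rewrite (_ : dsum_fun _ j =
  \sum_(i <- fset_set [set i | s i != 0]) dsum_inj_fun i (s i) j); last first.
  by elim/big_rec2: _ => // i y t _ <-.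
have [sj0|sj0] := eqVneq (s j) 0.
  by rewrite sj0 big1 // => i _; rewrite /dsum_inj_fun; case: eqP => [<-|].
rewrite (big_fsetD1 j) /=; last by rewrite in_fset_set // inE.
rewrite {1}/dsum_inj_fun eqxx big1_fset ?addr0 // => i; rewrite !inE.
by rewrite /dsum_inj_fun eq_sym => /andP[/negPf-> _].
Qed.

End DirectSumTheory.

Lemma dsum_projective (R : pzRingType) (I : Type) (C : lmodType R) :
  projective C -> projective (dsum I C : lmodType R).
Proof.
move=> Cproj.
(* [{classic I}] gives an arbitrary index type the choice structure that [dsum_lift] asks for. *)
suff : forall J : choiceType, projective (dsum J C : lmodType R) by move/(_ {classic I}).
move=> J A B g f gS.
have /choice[h gh] : forall i : J, exists h : {linear C -> A},
    forall c, g (h c) = f (dsum_inj i c).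
  by move=> i; apply: (Cproj A B g (f \o @dsum_inj R J C i) gS).
exists (dsum_lift h) => s.
have /asboolP sS := dsumP s.
rewrite -[in RHS](dsum_lift_id s) /=.
rewrite !(@dsum_liftE _ _ _ _ _ s [set i | s i != 0]) //.
rewrite !(fsbig_finite _ _ sS) !linear_sum.
by apply: eq_bigr => i _; rewrite gh.
Qed.

(** * The class [Add C] compared with the projective modules *)

Section AddClass.
Context (R : pzRingType) (C : lmodType R).
Implicit Types M N : lmodType R.

(** For a retraction [r] of [s], the complement is the kernel of [r]: each [d] splits as [s (r d)]
    plus [d - s (r d)]. *)
Lemma AddP M : Add C M <-> exists (I : Type) (s : {linear M -> dsum I C})
  (r : {linear dsum I C -> M}), cancel s r.
Proof.
split=> [[I [N [f /linear_inverse[g [fK gK]]]]]|[I [s [r sK]]]].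
  have /linear_bundle[s sE] : linear (fun m : M => f (m, 0)).
    by move=> a x y; rewrite -linearP; congr (f (_, _)); rewrite /= scaler0 addr0.
  have /linear_bundle[r rE] : linear (fun d => (g d).1).
    by move=> a x y; rewrite linearP.
  by exists I, s, r => m; rewrite rE sE fK.
have /linear_bundle[f fE] : linear (fun x : M * ker_module r => s x.1 + ker_val x.2).
  by move=> a x y; rewrite /= !linearP scalerDr addrACA.
have rk d : d - s (r d) \in ker_pred r by rewrite unfold_in linearB sK subrr.
exists I, (ker_module r), f.
exists (fun d => (r d, KerModule (rk d))) => [[m k]|d]; rewrite fE /=; last first.
  by rewrite addrC subrK.
have rE : r (s m + ker_val k) = m by rewrite linearD sK ker_valE addr0.
congr (_, _) => //; apply: val_inj => /=.
by rewrite rE addrC addKr.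
Qed.

Lemma Add_self : Add C C.
Proof.
apply/AddP; exists unit, (@dsum_inj R unit C tt).
exists (dsum_lift (fun _ : unit => idfun : {linear C -> C})).
exact: dsum_lift_inj.
Qed.

Lemma Add_bij M N (f : {linear M -> N}) : bijective f -> Add C M -> Add C N.
Proof.
move=> /linear_inverse[g [fK gK]] /AddP[I [s [r sK]]].
by apply/AddP; exists I, (s \o g), (f \o r) => x; rewrite /= sK gK.
Qed.

Lemma Add_projective M : projective C -> Add C M -> projective M.
Proof.
by move=> Cproj /AddP[I [s [r sK]]]; apply: projective_retract sK _; exact: dsum_projective.
Qed.

Lemma projective_Add M : generator C -> projective M -> Add C M.
Proof.
move=> /(_ M)[I [r rS]] Mproj; have [s sK] := projective_section Mproj rS.
by apply/AddP; exists I, s, r.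
Qed.

Lemma Add_dominated_generator :
  (forall M, exists (A : lmodType R) (f : {linear A -> M}), Add C A /\
     forall x, exists y, f y = x) -> generator C.
Proof.
move=> dom M; have [A [f [/AddP[I [s [r sK]]] fS]]] := dom M.
exists I, (f \o r) => x; have [y <-] := fS x.
by exists (s y); rewrite /= sK.
Qed.

(** For the converse, [C] itself lies in [Add C], and free covers, being projective, lie there too,
    so that [Add C] covers every module. *)
Lemma projective_generatorP :
  projective_generator C <-> forall M, Add C M <-> projective M.
Proof.
split=> [[Cproj Cgen] M|AP].
  by split; [exact: Add_projective|exact: projective_Add].
split; first by apply/AP/Add_self.
apply: Add_dominated_generator => M; exists (free_cover M), (free_aug M).
by split; [apply/AP/free_projective|exact: free_aug_surj].
Qed.

End AddClass.

(** * Building and truncating finite resolutions *)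

Section Resolutions.
Context (R : pzRingType).
Implicit Types (X : lmodType R -> Prop) (M : lmodType R).

Lemma ker_idE M (x : ker_module (idfun : {linear M -> M})) : x = 0.
Proof. by apply: val_inj; have /= := ker_valE x. Qed.

Lemma has_resolution0_self X M : X M -> has_resolution X M 0.
Proof.
move=> XM.
(* A zero module, used to pad the resolution in all positive degrees. *)
pose Z : lmodType R := ker_module (idfun : {linear M -> M}).
pose L i : lmodType R := if i is 0 then M else Z.
pose d i : {linear L i.+1 -> L i} := \0.
have aS (x : M) : exists y : L 0, (idfun : {linear L 0 -> M}) y = x by exists x.
have ea (x : L 0) : (idfun : {linear L 0 -> M}) x = 0 <-> exists y, d 0 y = x.
  by split=> [/= ->|[y <-]//]; exists 0.
have ed i (x : L i.+1) : d i x = 0 <-> exists y, d i.+1 y = x.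
  by split=> // _; exists 0; rewrite [RHS]ker_idE.
exists (LeftResolution aS ea ed); split=> [[|i]|[|i]] //= _ x.
exact: ker_idE.
Qed.

(** As [L 1] is zero, exactness at [L 0] makes the augmentation injective. *)
Lemma has_resolution0_bij X M : has_resolution X M 0 ->
  exists (L : lmodType R) (f : {linear L -> M}), X L /\ bijective f.
Proof.
move=> [L [LX L0]]; exists (L 0%N), (res_aug L); split; first exact: LX.
have inj : injective (res_aug L).
  move=> x y /eqP; rewrite -subr_eq0 -linearB => /eqP.
  move=> /res_exact_aug[z zxy]; apply/subr0_eq.
  by rewrite -zxy (L0 1%N isT z) linear0.
have /choice[g gK] := @res_aug_surj _ _ L.
by exists g => // x; apply: inj; rewrite gK.
Qed.

Lemma has_resolutionS X M m : has_resolution X M m.+1 ->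
  exists (L : lmodType R) (f : {linear L -> M}), [/\ X L, forall x, exists y, f y = x
    & has_resolution X (ker_module f) m].
Proof.
move=> [L [LX L0]]; exists (L 0%N), (res_aug L).
split; [exact: LX|exact: res_aug_surj|].
(* The first differential, corestricted to the kernel of the augmentation, becomes the augmentation
   of the shifted resolution. *)
have [|a aE] := @linear_factor_ker _ _ _ _ (res_aug L) (res_diff L 0).
  by move=> u; apply/res_exact_aug; exists u.
have aS x : exists y, a y = x.
  have /res_exact_aug[y yx] := ker_valE x.
  by exists y; apply: val_inj; rewrite /= aE.
have ea x : a x = 0 <-> exists y, res_diff L 1 y = x.
  rewrite -res_exact -aE; split=> [->|ax]; first exact: linear0.
  exact: val_inj.
exists (@LeftResolution R _ (fun i => L i.+1) (fun i => res_diff L i.+1) a aS ea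
  (fun i => @res_exact _ _ L i.+1)).
by split=> i im /=; [exact: LX|apply: L0].
Qed.

Lemma has_resolution_cover X M m : has_resolution X M m ->
  exists (L : lmodType R) (f : {linear L -> M}), X L /\ forall x, exists y, f y = x.
Proof.
by move=> [L [LX _]]; exists (L 0%N), (res_aug L); split;
  [exact: LX|exact: res_aug_surj].
Qed.

End Resolutions.

(** * Vanishing of Ext and dimension shifting *)

Section ExtVanishing.
Context (R : pzRingType) (M : lmodType R).
Implicit Types N A : lmodType R.

(* Ext^(i+1)(M, N) = 0: by the exact sequence 0 -> Omega^(i+1) M -> F_i ->
   Omega^i M -> 0, this says that Hom(F_i, N) -> Hom(Omega^(i+1) M, N) is
   onto. *)
Definition ext_vanishes i N := forall f : {linear syzygy M i.+1 -> N},
  exists g : {linear free_cover (syzygy M i) -> N},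
    forall k, g (ker_val k) = f k.

(** Composing [f] with the free cover of its source gives a cocycle. A cochain bounding it extends
    [f], because the cover is onto and can be cancelled. *)
Lemma Ext_ext_vanishes i N :
  (forall x : Ext i.+1 M N, x = 0) -> ext_vanishes i N.
Proof.
move=> E0 f; pose phi : HomR (free_resolution M i.+1) N :=
  (f \o free_aug _ : {linear free_cover (syzygy M i.+1) -> N}).
have phiC : phi \in @cocycle _ _ (free_resolution M) N i.+1.
  apply/eqP/hom_eq => x /=; rewrite /hom_fun /= /hom_fun /=.
  by rewrite ker_valE linear0.
pose z := Cocycle phiC.
(* Equality with zero in the quotient group, read back as membership in the coboundaries. *)
have : z - 0 \in @coboundary _ _ (free_resolution M) N i.+1.
  by rewrite Quotient.idealrBE; apply/eqP; rewrite [LHS]E0 [RHS]E0.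
rewrite subr0 => /asboolP[g gphi].
exists g => k; have [y <-] := free_aug_surj k.
exact: (congr1 (fun h => hom_fun h y) gphi).
Qed.

Lemma ext_vanishes_retract i N A (s : {linear N -> A}) (r : {linear A -> N}) :
  cancel s r -> ext_vanishes i A -> ext_vanishes i N.
Proof.
move=> sK vA f; have [g gE] := vA (s \o f).
by exists (r \o g) => k; rewrite /= gE /= sK.
Qed.

(** With K the kernel of [p], this is the part Ext^(i+1)(M, A) -> Ext^(i+1)(M, N) -> Ext^(i+2)(M, K)
    of the long exact sequence, chased by hand. *)
Lemma ext_vanishes_shift i N A (p : {linear A -> N}) :
    (forall x, exists y, p y = x) ->
    ext_vanishes i A -> ext_vanishes i.+1 (ker_module p) -> ext_vanishes i N.
Proof.
move=> pS vA vK f.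
(* Lift [f] through [p] on the free cover; on the next syzygy the lift [h] takes values in the
   kernel of [p], giving [u]. *)
have [h hE] := @free_projective _ _ _ _ p (f \o free_aug (syzygy M i.+1)) pS.
have [|u uE] := @linear_factor_ker _ _ _ _ p (h \o @ker_val _ _ _ (free_aug (syzygy M i.+1))).
  by move=> k; rewrite /= hE /= ker_valE linear0.
(* Once [u] is extended to [v], the difference of [h] and [v] vanishes on that syzygy and descends
   to a lift [w] of [f] to [A], which [vA] then extends. *)
have [v vE] := vK u.
have [k|w wE] := @linear_factor_surj _ _ _ _ (free_aug (syzygy M i.+1))
    (h \- (@ker_val _ _ _ p \o v)) (@free_aug_surj _ _).
  move=> /eqP k0; pose k' : syzygy M i.+2 := KerModule k0.
  have /= := vE k'. have /= := uE k'.
  by move=> <- ->; rewrite subrr.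
have [g gE] := vA w; exists (p \o g) => k.
have [y <-] := free_aug_surj k.
by rewrite /= gE wE /= linearB hE /= ker_valE subr0.
Qed.

Lemma ext_vanishes_Add C N i :
    (forall I : Type, ext_vanishes i (dsum I C)) -> Add C N ->
  ext_vanishes i N.
Proof. by move=> vC /AddP[I [s [r sK]]]; exact: ext_vanishes_retract sK (vC I). Qed.

Lemma ext_vanishes_resolution (X : lmodType R -> Prop) m N :
    (forall i A, X A -> ext_vanishes i A) -> has_resolution X N m ->
  forall i, ext_vanishes i N.
Proof.
(* The degree stays quantified in the induction, since each shift raises it by one. *)
move=> vX; elim: m N => [|m IH] N.
  move=> /has_resolution0_bij[A [f [XA /linear_inverse[g [_ gK]]]]] i.
  exact: ext_vanishes_retract gK (vX _ _ XA).
move=> /has_resolutionS[A [f [XA fS resK]]] i.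
by apply: (ext_vanishes_shift fS (vX _ _ XA)); apply: IH.
Qed.

(** Extending the identity of the first syzygy splits its inclusion into the free cover, so [M] is a
    summand of a free module. *)
Lemma ext_vanishes_projective : (forall N, ext_vanishes 0 N) -> projective M.
Proof.
move=> v0; have [g gE] := v0 (syzygy M 1) idfun.
(* Subtracting from the identity the projection onto the syzygy gives a map that kills the syzygy
   and descends to a section of [free_aug M]. *)
have [k k0|s sE] := @linear_factor_surj _ _ _ _ (free_aug M)
    (idfun \- (@ker_val _ _ _ (free_aug M) \o g)) (@free_aug_surj _ _).
  have k0' : k \in ker_pred (free_aug M) by apply/eqP.
  have /= := gE (KerModule k0').
  by move=> ->; rewrite subrr.
apply: (@projective_retract _ _ _ s (free_aug M)) (free_projective (I := M)).
move=> x; have [y <-] := free_aug_surj x.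
by rewrite sE /= linearB /= ker_valE subr0.
Qed.

End ExtVanishing.

(** * Global dimensions and the theorem *)

Section GlobalDimension.
Context (R : pzRingType).
Implicit Types (X : lmodType R -> Prop) (M : lmodType R).

Lemma left_dim_le X M (n : nat) :
  (left_dim X M <= n%:Z%:E)%E -> exists2 m, (m <= n)%N & has_resolution X M m.
Proof.
rewrite /left_dim; case: pselect => // ex_m; case: ex_minnP => m /asboolP resM _.
by rewrite lee_fin lez_nat => mn; exists m.
Qed.

Lemma left_dim_self X M : X M -> left_dim X M = 0%:Z%:E.
Proof.
move=> /has_resolution0_self/asboolP res0; rewrite /left_dim.
case: pselect => [ex_m|[]]; last by exists 0%N.
by case: ex_minnP => m _ /(_ _ res0); rewrite leqn0 => /eqP->.
Qed.

(* A finite value is not the default of [supremum], so it is attained as the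
   least upper bound. *)
Lemma left_gl_dim_resolution X (n : nat) M : left_gl_dim X = n%:Z%:E ->
  exists2 m, (m <= n)%N & has_resolution X M m.
Proof.
rewrite /left_gl_dim /supremum; case: ifP => // _.
case: xgetP => // _ -> [ub _] en.
by apply: left_dim_le; rewrite -en; apply: ub; exists M.
Qed.

Lemma left_gl_dim_all X : (forall M, X M) -> left_gl_dim X = 0%:Z%:E.
Proof.
move=> XT; rewrite /left_gl_dim (_ : [set _ | _] = [set 0%:Z%:E]) ?supremum1 //.
apply/seteqP; split=> [_ [M ->]|_ ->]; first exact: left_dim_self.
(* The empty direct sum serves as a module at which the value 0 is attained. *)
by exists (dsum void R^o); rewrite left_dim_self.
Qed.

Lemma PC_gl_dim_projective_generator (C : lmodType R) (n : nat) :
    Sigma_self_orthogonal C -> PC_gl_dim C = n%:Z%:E ->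
  projective_generator C.
Proof.
move=> hC dimC; have res M := left_gl_dim_resolution M dimC.
split; last first.
  apply: Add_dominated_generator => M.
  by have [m _ /has_resolution_cover] := res M.
apply: ext_vanishes_projective => N; have [m _ resN] := res N.
apply: ext_vanishes_resolution resN 0%N => i A; apply: ext_vanishes_Add => I.
(* Index [i] stands for Ext in degree [i.+1], which is positive as [hC] requires. *)
exact/Ext_ext_vanishes/hC.
Qed.

Lemma PC_gl_dimE (C : lmodType R) :
  projective_generator C -> PC_gl_dim C = gl_dim R.
Proof.
move=> /projective_generatorP AP; rewrite /PC_gl_dim /gl_dim.
by congr left_gl_dim; apply/funext => M; apply/propext/AP.
Qed.

End GlobalDimension.

Theorem corollary4p2 (R : pzRingType) (C : lmodType R)
    (hC : Sigma_self_orthogonal C) :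
  (forall n : nat, (0 < n)%N ->
     (PC_gl_dim C = n%:Z%:E%E <->
      gl_dim R = n%:Z%:E%E /\ projective_generator C))
  /\
  (projective_generator C <->
   (forall M : lmodType R, Add C M <-> projective M))
  /\
  (PC_gl_dim C = 0%:Z%:E%E <->
   (forall M : lmodType R, Add C M) /\
   (forall M : lmodType R, Add C M <-> projective M)).
Proof.
split=> [n _|].
  split=> [dimC|[dimR pgC]]; last by rewrite PC_gl_dimE.
  have pgC := PC_gl_dim_projective_generator hC dimC.
  by rewrite -(PC_gl_dimE pgC).
split; first exact: projective_generatorP.
split=> [dimC|[AT _]]; last exact: left_gl_dim_all.
split; last exact/projective_generatorP/(PC_gl_dim_projective_generator hC dimC).
move=> M; have [m] := left_gl_dim_resolution M dimC.
(* Length 0 means that the resolution is an isomorphism from a member of [Add C] onto [M]. *)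
rewrite leqn0 => /eqP-> /has_resolution0_bij[A [f [AA fbij]]].
exact: Add_bij fbij AA.
Qed.
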